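(* Let $E$ and $F$ be Banach spaces over the same field $\mathbb{K}$, where $\mathbb{K}=\mathbb{R}$ or $\mathbb{K}=\mathbb{C}$, and let $k,m$ be positive integers. Then every $(k,m)$-linear mapping $P:E^k\to F$ is a $km$-homogeneous polynomial on the vector space $E^k$, i.e. belongs to $\mathcal{P}_a(^{km}E^k;F)$.
   Context: A map $Q:G\to F$ between vector spaces over $\mathbb{K}$ is an $n$-homogeneous polynomial if there is an $n$-linear mapping $A:G^n\to F$ with $Q(x)=A(x,\ldots,x)$ for every $x\in G$; $\mathcal{P}_a(^{n}G;F)$ is the vector space of all such maps (no continuity required). A $(k,m)$-linear mapping is a mapping $P:E^k\to F$ such that for each $1\le j\le k$ and all fixed $x_i\in E$ ($i\ne j$) the mapping $P(x_1,\ldots,x_{j-1},\cdot,x_{j+1},\ldots,x_k):E\to F$ is an $m$-homogeneous polynomial (equivalently, it is an $(m,\ldots,m)$-homogeneous polynomial with $k$ entries equal to $m$). $E^k$ carries the componentwise vector space structure. *)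

(* Defs.v *)
From HB Require Import structures.
From mathcomp Require Import all_boot all_order all_algebra.
From mathcomp Require Import complex.
From mathcomp Require Import all_classical all_reals all_analysis.
Import GRing.Theory Num.Theory.

Set Implicit Arguments.
Unset Strict Implicit.
Unset Printing Implicit Defensive.

Local Open Scope ring_scope.

(* [(G ^ n)%type] is [{ffun 'I_n -> G}], whose lmodType structure is the
   componentwise one.  [subst_entry x i y] is
   (x_1, ..., x_{i-1}, y, x_{i+1}, ..., x_n). *)
Definition subst_entry (G : Type) (n : nat) (x : (G ^ n)%type) (i : 'I_n)
    (y : G) : (G ^ n)%type :=
  [ffun j => if j == i then y else x j].

Definition nlinear (K : pzRingType) (n : nat) (G F : lmodType K)
    (A : (G ^ n)%type -> F) : Prop :=
  forall (i : 'I_n) (x : (G ^ n)%type), linear (fun y => A (subst_entry x i y)).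

Definition homogeneous_polynomial (K : pzRingType) (n : nat)
    (G F : lmodType K) (Q : G -> F) : Prop :=
  exists A : (G ^ n)%type -> F, nlinear A /\ forall x, Q x = A [ffun=> x].

Definition kmlinear (K : pzRingType) (k m : nat) (E F : lmodType K)
    (P : (E ^ k)%type -> F) : Prop :=
  forall (j : 'I_k) (x : (E ^ k)%type),
    homogeneous_polynomial m (fun y => P (subst_entry x j y)).

Arguments nlinear {K} n {G F} A.
Arguments homogeneous_polynomial {K} n {G F} Q.
Arguments kmlinear {K} k m {E F} P.

(* Main.v *)
Require Import Defs.
From mathcomp Require Import all_boot all_order all_algebra.
From mathcomp Require Import complex.
From mathcomp Require Import all_classical all_reals all_analysis.

(* Polarization.  If [A] is [m]-linear with diagonal [Q], then
   [\sum_S (-1)^(m - #|S|) Q(\sum_(i in S) x_i)], over the subsets [S] of the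
   index set, is the sum of [A(x_(f 1), ..., x_(f m))] over the permutations
   [f], hence is [m]-linear in [x]; and it is expressed by values of [Q] only.
   Applying this operator to each of the [k] entries of [P] therefore gives a
   map of [k * m] vectors that is linear in each of them, and by homogeneity
   its diagonal is a nonzero scalar multiple of [P]. *)

Set Implicit Arguments.
Unset Strict Implicit.

Import GRing.Theory Num.Theory.
Local Open Scope ring_scope.

(** * Replacing one entry of a tuple *)

Section SubstEntry.
Variables (G : Type) (n : nat).
Implicit Types (x : (G ^ n)%type) (i : 'I_n) (y : G).

Lemma subst_entry_same x i y : subst_entry x i y i = y.
Proof. by rewrite ffunE eqxx. Qed.

Lemma subst_entry_subst x i y z :
  subst_entry (subst_entry x i y) i z = subst_entry x i z.
Proof. by apply/ffunP => j; rewrite !ffunE; case: eqP. Qed.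

Lemma subst_entry_id x i : subst_entry x i (x i) = x.
Proof. by apply/ffunP => j; rewrite !ffunE; case: eqP => // ->. Qed.

End SubstEntry.

(** Functions are grouped by their values off [j]; the one taking the value [t0] at [j] represents
    its group. *)
Lemma big_subst_entry (V : nmodType) (T : finType) (n : nat) (j : 'I_n)
    (t0 : T) (p : pred (T ^ n)%type) (g : (T ^ n)%type -> V) :
  (forall f t, p (subst_entry f j t) = p f) ->
  \sum_(f | p f) g f =
  \sum_(f | p f && (f j == t0)) \sum_t g (subst_entry f j t).
Proof.
move=> hp.
rewrite (partition_big (fun f => subst_entry f j t0)
  (fun f => p f && (f j == t0))) /=; last first.
  by move=> f pf; rewrite hp pf subst_entry_same eqxx.
apply: eq_bigr => h /andP[ph /eqP hj].
rewrite (reindex_onto (fun t => subst_entry h j t) (fun f => f j)) /=; last first.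
  by move=> f /andP[_ /eqP <-]; rewrite subst_entry_subst subst_entry_id.
apply: eq_bigl => t.
by rewrite hp ph subst_entry_subst subst_entry_same -hj subst_entry_id !eqxx.
Qed.

Section Linear.
Variables (K : pzRingType) (G F : lmodType K).

Lemma linear_sum_fun (I : Type) (r : seq I) (p : pred I) (h : I -> G -> F) :
  (forall i, p i -> linear (h i)) ->
  linear (fun y => \sum_(i <- r | p i) h i y).
Proof.
move=> hl a u v; rewrite scaler_sumr -big_split /=.
by apply: eq_bigr => i pi; rewrite hl.
Qed.

Lemma linear_map0 (h : G -> F) : linear h -> h 0 = 0.
Proof. by move=> /(_ (-1) 0 0); rewrite scaler0 addr0 scaleN1r addNr. Qed.

Lemma linear_map_sum (h : G -> F) : linear h ->
  forall (I : Type) (r : seq I) (v : I -> G),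
  h (\sum_(i <- r) v i) = \sum_(i <- r) h (v i).
Proof.
move=> hl I r v; apply: (big_morph h) => [x y|]; last exact: linear_map0.
by have := hl 1 x y; rewrite !scale1r.
Qed.

Lemma linear_map_scale (h : G -> F) : linear h ->
  forall a y, h (a *: y) = a *: h y.
Proof.
by move=> hl a y; have := hl a y 0; rewrite linear_map0 // !addr0.
Qed.

End Linear.

(** * Expansion and scaling of multilinear maps *)

Section Expansion.
Variables (K : pzRingType) (G F : lmodType K) (n : nat).
Variables (A : (G ^ n)%type -> F) (hA : nlinear n A).

Lemma nlinear_sum (T : finType) (t0 : T) (v : 'I_n -> T -> G) :
  A [ffun j => \sum_t v j t] = \sum_(f : (T ^ n)%type) A [ffun j => v j (f j)].
Proof.
(* The entries are expanded one at a time; those outside [s] still wait. *)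
have H (s : seq 'I_n) (w : (G ^ n)%type) : uniq s ->
    A [ffun j => if j \in s then \sum_t v j t else w j] =
    \sum_(f : (T ^ n)%type | [forall j, (j \notin s) ==> (f j == t0)])
       A [ffun j => if j \in s then v j (f j) else w j].
  elim: s w => [|j s IH] w /=.
    move=> _; rewrite (big_pred1 [ffun=> t0]) => [|f].
      by congr A; apply/ffunP => j; rewrite !ffunE.
    apply/forallP/eqP => [h|-> j]; last by rewrite ffunE.
    by apply/ffunP => j; rewrite ffunE; apply/eqP/h.
  move=> /andP[js us].
  rewrite (big_subst_entry (j := j) t0); last first.
    move=> f t; apply: eq_forallb => i; rewrite ffunE inE.
    by case: eqP.
  rewrite exchange_big /=.
  transitivity (A (subst_entry [ffun i => if i \in s then \sum_t v i t else w i]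
                    j (\sum_t v j t))).
    by congr A; apply/ffunP => i; rewrite !ffunE inE; case: eqP => // ->.
  rewrite (linear_map_sum (hA j _)); apply: eq_bigr => t _.
  (* As [j] is not in [s], the chosen vector [v j t] can be stored in [w] as a waiting entry, and
     the induction hypothesis applies. *)
  transitivity (A [ffun i => if i \in s then \sum_t v i t
                             else subst_entry w j (v j t) i]).
    congr A; apply/ffunP => i; rewrite !ffunE; case: eqP => // ->.
    by rewrite (negPf js).
  rewrite IH //; apply: eq_big => [f|f _].
    apply/forallP/andP => [h|[/forallP h fj] i].
      split; last exact: (implyP (h j)).
      apply/forallP => i; apply/implyP; rewrite inE negb_or => /andP[_].
      exact: (implyP (h i)).
    apply/implyP => hi; case: (eqVneq i j) => [-> //|ij].
    by apply: (implyP (h i)); rewrite inE negb_or ij.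
  congr A; apply/ffunP => i; rewrite !ffunE inE; case: eqP => [->|//].
  by rewrite (negPf js).
have := H (enum 'I_n) 0 (enum_uniq _).
under eq_ffun => j do rewrite mem_enum /=.
move->; apply: eq_big => [f|f _].
  by apply/forallP => j; rewrite mem_enum.
by congr A; apply/ffunP => j; rewrite !ffunE mem_enum.
Qed.

End Expansion.

(** Scalars are pulled out one entry at a time. The case [d = 1] serves multilinear maps, the case
    [d = m] serves [P] itself. *)
Lemma multihomogeneous_scale {K : comPzRingType} {G F : lmodType K} {n d : nat}
    {P : (G ^ n)%type -> F} :
  (forall j x a y,
     P (subst_entry x j (a *: y)) = a ^+ d *: P (subst_entry x j y)) ->
  forall (a : 'I_n -> K) (x : 'I_n -> G),
  P [ffun j => a j *: x j] = (\prod_j a j ^+ d) *: P [ffun j => x j].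
Proof.
move=> hP a x.
have H (s : seq 'I_n) : uniq s ->
    P [ffun j => if j \in s then a j *: x j else x j] =
    (\prod_(j <- s) a j ^+ d) *: P [ffun j => x j].
  elim: s => [_|j s IH /= /andP[js us]].
    by rewrite big_nil scale1r; congr P; apply/ffunP => j; rewrite !ffunE.
  rewrite big_cons -scalerA -IH //.
  set w := [ffun i => if i \in s then _ else _].
  have wj : w j = x j by rewrite ffunE (negPf js).
  rewrite -[in RHS](subst_entry_id w j) wj -hP; congr P.
  by apply/ffunP => i; rewrite !ffunE inE; case: eqP => // ->.
have := H (enum 'I_n) (enum_uniq _); rewrite big_enum /= => <-.
by congr P; apply/ffunP => j; rewrite !ffunE mem_enum.
Qed.

Lemma homogeneous_polynomial_scale {K : comPzRingType} {G F : lmodType K}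
    {m : nat} {Q : G -> F} :
  homogeneous_polynomial m Q -> forall a y, Q (a *: y) = a ^+ m *: Q y.
Proof.
move=> [A [hA QA]] a y; rewrite !QA.
have h1 j x b z : A (subst_entry x j (b *: z)) = b ^+ 1 *: A (subst_entry x j z).
  by rewrite expr1 (linear_map_scale (hA j x)).
rewrite (multihomogeneous_scale h1 (fun=> a) (fun=> y)).
by rewrite prodr_const card_ord expr1.
Qed.

(** * The polarization formula *)

Section Polarization.
Variable K : comPzRingType.

(** This is $(-1)^{m-|S|}$, written as a product over all indices so that sums over [S] become
    expanded products. *)
Definition polar_sign {m} (S : {set 'I_m}) : K :=
  \prod_i (if i \in S then 1 else -1).

(* Inclusion-exclusion over the sets [S] that contain the image of [f]. *)
Lemma sum_polar_sign {m} (f : ('I_m ^ m)%type) :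
  \sum_(S : {set 'I_m}) polar_sign S * \prod_j (f j \in S)%:R =
  (injectiveb f)%:R.
Proof.
(* The factor of an index outside [S]: it is 0 on the image of [f], which kills every [S] not
   containing that image. *)
pose a i : K := if i \in codom f then 0 else -1.
have E (S : {set 'I_m}) : polar_sign S * \prod_j (f j \in S)%:R =
    \prod_i (if i \in S then 1 else a i).
  have [sub|nsub] := boolP [forall j, f j \in S].
    rewrite [X in _ * X]big1 ?mulr1 => [|j _]; last by rewrite (forallP sub).
    apply: eq_bigr => i _; case: ifP => // iS; rewrite /a; case: ifP => //.
    by case/codomP => j ij; rewrite ij (forallP sub) in iS.
  move: nsub; rewrite negb_forall => /existsP[j jS].
  rewrite (bigD1 j) //= (negPf jS) mul0r mulr0 (bigD1 (f j)) //= (negPf jS).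
  by rewrite /a codom_f mul0r.
rewrite (eq_bigr _ (fun S _ => E S)).
(* The factor [1 + a i] is 1 on the image of [f] and 0 off it, so the product tests surjectivity,
   which for a self-map of a finite set is injectivity. *)
transitivity (\prod_i (1 + a i)).
  by rewrite bigA_distr.
have [/injectiveP finj|ninj] := boolP (injectiveb f).
  rewrite big1 // => i _; rewrite /a.
  suff -> : i \in codom f by rewrite addr0.
  by apply: inj_card_onto.
have [i iN] : exists i, i \notin codom f.
  apply/existsP; rewrite -negb_forall; apply: contra ninj => /forallP sur.
  rewrite /injectiveb /dinjectiveb; apply/card_uniqP.
  rewrite size_map -cardE; apply: eq_card => i.
  by rewrite [LHS]sur.
by rewrite (bigD1 i) //= /a (negPf iN) subrr mul0r.
Qed.

(** Each [Q (\sum_(i in S) x i)] is expanded by multilinearity; after exchanging the sums, the signs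
    cancel all terms with [f] not injective. *)
Lemma polarization {G F : lmodType K} {m : nat} (t0 : 'I_m) {Q : G -> F}
    {A : (G ^ m)%type -> F} (hA : nlinear m A)
    (QA : forall x, Q x = A [ffun=> x]) (x : (G ^ m)%type) :
  \sum_(S : {set 'I_m}) polar_sign S *: Q (\sum_(i in S) x i) =
  \sum_(f : ('I_m ^ m)%type | injectiveb f) A [ffun j => x (f j)].
Proof.
have h1 j w b z : A (subst_entry w j (b *: z)) = b ^+ 1 *: A (subst_entry w j z).
  by rewrite expr1 (linear_map_scale (hA j w)).
have E (S : {set 'I_m}) : polar_sign S *: Q (\sum_(i in S) x i) =
    \sum_(f : ('I_m ^ m)%type)
      (polar_sign S * \prod_j (f j \in S)%:R) *: A [ffun j => x (f j)].
  rewrite QA.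
  (* Indicator coefficients make the range of summation independent of [S]. *)
  transitivity (polar_sign S *: A [ffun j => \sum_t (t \in S)%:R *: x t]).
    congr (_ *: A _); apply/ffunP => j; rewrite !ffunE big_mkcond.
    by apply: eq_bigr => t _; case: ifP => _; rewrite ?scale1r ?scale0r.
  rewrite (nlinear_sum hA t0) scaler_sumr; apply: eq_bigr => f _.
  rewrite (multihomogeneous_scale h1 (fun j => (f j \in S)%:R)) scalerA.
  by under eq_bigr do rewrite expr1.
rewrite (eq_bigr _ (fun S _ => E S)) exchange_big /= [RHS]big_mkcond.
apply: eq_bigr => f _; rewrite -scaler_suml sum_polar_sign.
by case: ifP; rewrite ?scale1r ?scale0r.
Qed.

Lemma polar_linear {G F : lmodType K} {m : nat} {Q : G -> F} :
  homogeneous_polynomial m Q ->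
  nlinear m (fun x : (G ^ m)%type =>
    \sum_(S : {set 'I_m}) polar_sign S *: Q (\sum_(i in S) x i)).
Proof.
move=> [A [hA QA]] i x.
suff: linear (fun y => \sum_(f : ('I_m ^ m)%type | injectiveb f)
                 A [ffun j => subst_entry x i y (f j)]).
  by move=> h a u v; rewrite !(polarization i hA QA); apply: h.
apply: linear_sum_fun => f /injectiveP finj.
(* As [f] is a permutation, [x i] fills exactly one slot of [A], the slot [j] with [f j = i]. *)
have [j fj] : exists j, i = f j by apply/codomP/inj_card_onto.
have E y : A [ffun l => subst_entry x i y (f l)] =
    A (subst_entry [ffun l => x (f l)] j y).
  congr A; apply/ffunP => l; rewrite !ffunE fj.
  by rewrite (inj_eq finj).
by move=> a u v; rewrite !E; apply: hA.
Qed.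

(** The factor by which polarization multiplies [Q] on the diagonal, where $Q(|S|x)=|S|^m Q(x)$; its
    value is $m!$. *)
Definition polar_const m : K :=
  \sum_(S : {set 'I_m}) polar_sign S * #|S|%:R ^+ m.

(** $|S|^m$ counts the maps into [S], so exchanging the sums leaves one unit for each injective
    [f]. *)
Lemma polar_constE m :
  polar_const m = #|[set f : ('I_m ^ m)%type | injectiveb f]|%:R.
Proof.
have E (S : {set 'I_m}) : polar_sign S * #|S|%:R ^+ m =
    \sum_(f : ('I_m ^ m)%type) polar_sign S * \prod_j (f j \in S)%:R.
  rewrite -mulr_sumr -(bigA_distr_bigA (fun _ t => (t \in S)%:R)) /=.
  rewrite prodr_const card_ord -sum1_card natr_sum big_mkcond /=.
  by congr (_ * _ ^+ _); apply: eq_bigr => t _; case: ifP.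
rewrite /polar_const (eq_bigr _ (fun S _ => E S)) exchange_big /=.
under eq_bigr do rewrite sum_polar_sign.
rewrite -sum1dep_card natr_sum [RHS]big_mkcond /=.
by apply: eq_bigr => f _; case: ifP.
Qed.

End Polarization.

Lemma polar_const_neq0 (K : numDomainType) m : polar_const K m != 0.
Proof.
rewrite polar_constE pnatr_eq0 -lt0n; apply/card_gt0P.
by exists [ffun i => i]; rewrite inE; apply/injectiveP => i j; rewrite !ffunE.
Qed.

(** * Polarization in all [k] entries *)

Section MultiPolarization.
Variables (K : numFieldType) (E F : lmodType K) (k m : nat).
Variables (P : (E ^ k)%type -> F) (hP : kmlinear k m P).

(** The [k * m] arguments are indexed by pairs [(j, i)]. Each lies in [E ^ k], but argument [(j, i)]
    enters only through its coordinate [j]. *)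
Definition multipolar (z : ((E ^ k) ^ (k * m))%type) : F :=
  \sum_(S : ({set 'I_m} ^ k)%type)
    (\prod_j polar_sign K (S j)) *:
    P [ffun j => \sum_(i in S j) z (mxvec_index j i) j].

Lemma mxvec_index_eq (j j' : 'I_k) (i i' : 'I_m) :
  (mxvec_index j i == mxvec_index j' i') = ((j == j') && (i == i')).
Proof.
by rewrite /mxvec_index (inj_eq (@cast_ord_inj _ _ _)) (inj_eq enum_rank_inj).
Qed.

Lemma multipolar_linear : nlinear (k * m) multipolar.
Proof.
move=> q z; case/mxvec_indexP: q => j0 i0.
pose w (S : ({set 'I_m} ^ k)%type) : (E ^ k)%type :=
  [ffun j => \sum_(i in S j) z (mxvec_index j i) j].
pose x : (E ^ m)%type := [ffun i => z (mxvec_index j0 i) j0].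
(* The subset at entry [j0] is split off as [U], leaving the polarization of [P] in that entry
   alone. The placeholder [finset.set0] at [j0] is never read: the product omits [j0] and [w S] is
   overwritten there. *)
have H y : multipolar (subst_entry z (mxvec_index j0 i0) y) =
    \sum_(S : ({set 'I_m} ^ k)%type | true && (S j0 == finset.set0))
      (\prod_(j | j != j0) polar_sign K (S j)) *:
      \sum_(U : {set 'I_m}) polar_sign K U *:
        P (subst_entry (w S) j0 (\sum_(i in U) subst_entry x i0 (y j0) i)).
  rewrite /multipolar (big_subst_entry (j := j0) finset.set0) //.
  apply: eq_bigr => S _; rewrite scaler_sumr; apply: eq_bigr => U _.
  rewrite scalerA; congr (_ *: P _).
    rewrite (bigD1 j0) //= subst_entry_same mulrC; congr (_ * _).
    by apply: eq_bigr => j /negPf jj; rewrite ffunE jj.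
  apply/ffunP => j; rewrite !ffunE; case: (eqVneq j j0) => [->|jj].
    apply: eq_bigr => i _; rewrite !ffunE mxvec_index_eq eqxx /=.
    by case: ifP.
  by apply: eq_bigr => i _; rewrite !ffunE mxvec_index_eq (negPf jj).
move=> a u v; rewrite !H.
move: a (u) (v); apply: linear_sum_fun => S _ a u1 v1.
have := polar_linear (hP j0 (w S)) i0 x a (u1 j0) (v1 j0) => /= hl.
have -> : (a *: u1 + v1) j0 = a *: u1 j0 + v1 j0 by rewrite !ffunE.
by rewrite hl scalerDr !scalerA mulrC.
Qed.

Lemma multipolar_diag (x : (E ^ k)%type) :
  multipolar [ffun=> x] = polar_const K m ^+ k *: P x.
Proof.
have hom j y a u := homogeneous_polynomial_scale (hP j y) a u.
(* The [k]-th power is expanded into a sum over families [S] of subsets, to be matched termwise: on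
   the diagonal entry [j] is [#|S j|%:R *: x j]. *)
rewrite -[in RHS](card_ord k) -prodr_const /polar_const bigA_distr_bigA /=.
rewrite scaler_suml; apply: eq_bigr => S _.
rewrite big_split /= -scalerA; congr (_ *: _).
transitivity (P [ffun j => #|S j|%:R *: x j]).
  congr P; apply/ffunP => j; rewrite !ffunE scaler_nat -sumr_const.
  by apply: eq_bigr => i _; rewrite ffunE.
rewrite (multihomogeneous_scale hom); congr (_ *: P _).
by apply/ffunP => j; rewrite ffunE.
Qed.

Lemma kmlinear_homogeneous_polynomial : homogeneous_polynomial (k * m) P.
Proof.
(* Dividing by $(m!)^k$, nonzero in [K], normalizes the diagonal to [P]. *)
exists (fun z => (polar_const K m ^+ k)^-1 *: multipolar z); split=> [q z a u v|x].
  by rewrite multipolar_linear scalerDr !scalerA mulrC.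
by rewrite multipolar_diag scalerK // expf_neq0 // polar_const_neq0.
Qed.

End MultiPolarization.

Unset Implicit Arguments.

Theorem mainTheorem3 (R : realType) (K : numFieldType)
    (hK : K = (R : numFieldType) \/ K = (R[i]%C : numFieldType))
    (E F : completeNormedModType K) (k m : nat) (hk : (0 < k)%N) (hm : (0 < m)%N)
    (P : (E ^ k)%type -> F) (hP : kmlinear k m P) :
  homogeneous_polynomial (k * m) P.
Proof. exact: kmlinear_homogeneous_polynomial hP. Qed.
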